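(* Let $q$ be a prime power, $N\ge 1$, and let $t,k,v$ be integers with $0\le t\le k-1$ and $t\le v-1$. If there exist an $\mathrm{LS}_q[N](t,k-1,v-1)$ and an $\mathrm{LS}_q[N](t,k,v-1)$, then there exists an $\mathrm{LS}_q[N](t,k,v)$.
   Context: For a $v$-dimensional vector space $V$ over the finite field $\mathrm{GF}(q)$, a pair $(V,\mathcal{B})$ with $\mathcal{B}$ a set of $k$-dimensional subspaces of $V$ is a $t$-$(v,k,\lambda)_q$ (subspace) design if every $t$-dimensional subspace of $V$ is contained in exactly $\lambda$ elements of $\mathcal{B}$. A large set $\mathrm{LS}_q[N](t,k,v)$ is a family $(V,\mathcal{B}_1),\ldots,(V,\mathcal{B}_N)$ of $t$-$(v,k,\lambda)_q$ designs on the same $v$-dimensional $\mathrm{GF}(q)$-vector space $V$, all with the same $\lambda$, such that the block sets $\mathcal{B}_1,\ldots,\mathcal{B}_N$ are pairwise disjoint and their union is the set of all $k$-dimensional subspaces of $V$. (In degenerate cases the $\mathcal{B}_i$ may be empty.) *)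

(* Defs.v *)
From HB Require Import structures.
From mathcomp Require Import all_boot all_order all_algebra.

Set Implicit Arguments.
Unset Strict Implicit.
Unset Printing Implicit Defensive.

(* Over a finite field the subspaces of V form a finite type, so that block
   sets can be elements of {set {vspace V}}. *)
Section FiniteSubspaces.
Import VectorInternalTheory.
Variables (F : finFieldType) (V : vectType F).
HB.instance Definition _ := [Countable of {vspace V} by <:].
HB.instance Definition _ := [Finite of {vspace V} by <:].
End FiniteSubspaces.

(* GF(q) is represented by a finite field F, with q = #|F|. *)
Section SubspaceDesigns.

Variable F : finFieldType.

Definition subspace_design (V : vectType F) (t v k lambda : nat)
    (B : {set {vspace V}}) : Prop :=
  [/\ \dim {:V} = v,
      forall K : {vspace V}, K \in B -> \dim K = k &
      forall T : {vspace V}, \dim T = t ->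
        #|[set K in B | (T <= K)%VS]| = lambda].

Definition large_set (V : vectType F) (N t k v : nat)
    (B : 'I_N -> {set {vspace V}}) : Prop :=
  [/\ \dim {:V} = v,
      exists lambda : nat, forall i, subspace_design t v k lambda (B i),
      forall i j, i != j -> [disjoint B i & B j] &
      \bigcup_(i < N) B i = [set K : {vspace V} | \dim K == k]].

Definition large_set_exists (N t k v : nat) : Prop :=
  exists (V : vectType F) (B : 'I_N -> {set {vspace V}}), large_set t k v B.

End SubspaceDesigns.

(* Main.v *)
(* Fix a line P in the v-dimensional space V and project along P onto spaces of
   dimension v - 1.  Part i of the new large set consists of the K through P
   whose image lies in part i of the first large set, and of the K not through
   P whose image lies in part i of the second.  A (k+1)-space M through P
   contains as many k-spaces K that avoid P and contain a given t-space T, P not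
   in T, as any other such M; hence the number of blocks of part i containing T
   does not depend on i.  Since all the k-spaces containing T are thereby shared
   out equally, this number is [v-t choose k-t]_q / N for every T. *)
Require Import Defs.
From mathcomp Require Import all_boot all_order all_algebra all_field.

Set Implicit Arguments.
Unset Strict Implicit.
Unset Printing Implicit Defensive.

(** * Counting subspaces between two given ones *)

Section Counting.
Variables (F : finFieldType) (V : vectType F).
Implicit Types (S T U K L M P : {vspace V}) (B : {set {vspace V}}).
Local Notation fV := (finvect_type V).
Local Notation q := #|F|.

Lemma card_mem_vspace U : #|[pred x : fV | x \in U]| = q ^ \dim U.
Proof.
case: V U => W cW U.
rewrite -(@card_vspace F (finvect_type (Vector.Pack cW)) cW U).
exact: eq_card.
Qed.

Lemma card_vspace_diff S M : (S <= M)%VS ->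
  #|[pred x : fV | (x \in M) && (x \notin S)]| = q ^ \dim M - q ^ \dim S.
Proof.
move=> sSM.
rewrite -!card_mem_vspace -(cardID [pred x : fV | x \in S] [pred x : fV | x \in M]).
rewrite (_ : #|[predI _ & _]| = #|[pred x : fV | x \in S]|).
  by rewrite addKn; apply: eq_card => x; rewrite !inE andbC.
apply: eq_card => x; rewrite !inE /= andbC.
by case xS: (x \in S) => //=; rewrite (subvP sSM).
Qed.

(* Double count the pairs (x, K) with x in M \ S, K in B and S + <[x]> <= K. *)
Lemma design_step B M S k s lambda :
    {in B, forall K, \dim K = k /\ (K <= M)%VS} ->
    (S <= M)%VS -> \dim S = s ->
    (forall T, (T <= M)%VS -> \dim T = s.+1 ->
      #|[set K in B | (T <= K)%VS]| = lambda) ->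
  #|[set K in B | (S <= K)%VS]| * (q ^ k - q ^ s)
    = (q ^ \dim M - q ^ s) * lambda.
Proof.
move=> hB sSM dimS hT; rewrite -dimS -(card_vspace_diff sSM).
rewrite -!sum_nat_const.
transitivity (\sum_(K in B | (S <= K)%VS)
    \sum_(x : fV | (x \in K) && (x \notin S)) 1).
  apply: eq_big => K; rewrite !inE // => /andP[KB SK].
  by rewrite sum1_card card_vspace_diff //; have [-> _] := hB K KB.
transitivity (\sum_(x : fV | (x \in M) && (x \notin S))
    \sum_(K in B | (S + <[x : V]> <= K)%VS) 1); last first.
  apply: eq_bigr => x /andP[xM xS]; rewrite sum1dep_card; apply: hT.
    by rewrite subv_add sSM.
  have x0 : (x : V) != 0%R by apply: contraNneq xS => ->; exact: mem0v.
  rewrite dimv_disjoint_sum ?dim_vline ?x0 ?addn1 ?dimS //.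
  apply/eqP; rewrite -subv0; apply/subvP => y; rewrite memv_cap memv0.
  case/andP=> yS /vlineP[a ya]; move: yS; rewrite {}ya.
  have [-> _|a0] := eqVneq a 0%R; first by rewrite GRing.scale0r.
  by rewrite GRing.rpredZeq (negPf a0) (negPf xS).
rewrite (exchange_big_dep (fun x : fV => (x \in M) && (x \notin S))) /=.
  apply: eq_bigr => x /andP[xM xS]; apply: eq_bigl => K.
  by rewrite subv_add -memvE xS andbT andbA.
by move=> K x /andP[/hB[_ /subvP KM] _] /andP[/KM-> ->].
Qed.

(** The number is the Gaussian binomial [m-t choose k-t]_q, but only its independence of [M] and [T]
    matters. Induction on k - t: [design_step], applied to all k-spaces of [M], passes from t+1 to
    t. *)
Lemma card_between_uniform m k t : exists g, forall M T,
  \dim M = m -> \dim T = t -> (T <= M)%VS ->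
  #|[set K | [&& \dim K == k, (T <= K)%VS & (K <= M)%VS]]| = g.
Proof.
have [lt_kt|le_tk] := ltnP k t.
  exists 0 => M T _ dT _; apply/eqP; rewrite cards_eq0 -subset0.
  apply/subsetP => K; rewrite inE => /and3P[/eqP dK /dimvS].
  by rewrite dT dK leqNgt lt_kt.
have {le_tk} [d ->] : exists d, k = t + d by exists (k - t); rewrite subnKC.
elim: d t => [|d IHd] t.
  exists 1 => M T _ dT TM; rewrite addn0 -(cards1 T); congr #|pred_of_set _|.
  apply/setP => K; rewrite !inE.
  apply/and3P/eqP => [[/eqP dK TK _]|->]; last by rewrite dT.
  by apply/esym/eqP; rewrite eqEdim TK dK dT /=.
have [g hg] := IHd t.+1; rewrite addSnnS in hg.
pose c := q ^ (t + d.+1) - q ^ t.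
(* This is the identity of [design_step] solved for the count; the division is exact because [c] is
   positive. *)
exists ((q ^ m - q ^ t) * g %/ c) => M T dM dT TM.
have c_gt0 : 0 < c.
  by rewrite subn_gt0 ltn_exp2l ?finNzRing_gt1 // addnS ltnS leq_addr.
rewrite -dM -(@design_step [set K | (\dim K == t + d.+1) && (K <= M)%VS] _ T
  (t + d.+1)) //.
- rewrite mulnK //; apply: eq_card => K; rewrite !inE.
  by rewrite -andbA; congr andb; rewrite andbC.
- by move=> K; rewrite inE => /andP[/eqP].
move=> U UM dU; rewrite -(hg M U dM dU UM); apply: eq_card => K.
by rewrite !inE -andbA; congr andb; rewrite andbC.
Qed.
End Counting.

(** * Projection along a line, the kernel of [f] *)

Section Quotient.
Variables (F : finFieldType) (V W : vectType F) (f : 'Hom(V, W)).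
Hypotheses (limg_f : limg f = fullv) (dim_ker : \dim (lker f) = 1).
Implicit Types (T K M : {vspace V}) (L : {vspace W}) (B : {set {vspace W}}).

Lemma subv_lpreim K L : (K <= f @^-1: L)%VS = (f @: K <= L)%VS.
Proof.
apply/idP/idP => [/(limgS f)|fKL]; first by rewrite lpreimK // limg_f subvf.
by apply/subvP => x xK; rewrite -memv_preim (subvP fKL) ?memv_img.
Qed.

Lemma lker_lpreim L : (lker f <= f @^-1: L)%VS.
Proof. by rewrite -lpreim0 lpreimS ?sub0v. Qed.

Lemma dim_limg_sub K : (lker f <= K)%VS -> \dim K = (\dim (f @: K)).+1.
Proof. by move=> /capv_idPr kK; rewrite -(limg_ker_dim f K) kK dim_ker. Qed.

Lemma capv_lker0 K : ~~ (lker f <= K)%VS -> (K :&: lker f = 0)%VS.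
Proof.
apply: contraNeq; rewrite -dimv_eq0 -lt0n => cap_gt0.
by apply/capv_idPr/eqP; rewrite eqEdim capvSr dim_ker.
Qed.

Lemma dim_limg_nsub K : ~~ (lker f <= K)%VS -> \dim (f @: K) = \dim K.
Proof. by move/capv_lker0/limg_dim_eq. Qed.

Lemma dim_lpreim L : \dim (f @^-1: L) = (\dim L).+1.
Proof. by rewrite dim_limg_sub ?lker_lpreim // lpreimK // limg_f subvf. Qed.

Lemma limgK K : (lker f <= K)%VS -> (f @^-1: (f @: K))%VS = K.
Proof.
move=> kK; apply/esym/eqP; rewrite eqEdim subv_lpreim subvv /=.
by rewrite dim_lpreim -dim_limg_sub.
Qed.

(** Taking preimages is a bijection from the subspaces of [W] to the subspaces of [V] through the
    kernel, and it turns the condition f(T) <= L into T <= K. *)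
Lemma card_lift_sub B T :
  #|[set K | [&& (lker f <= K)%VS, (f @: K)%VS \in B & (T <= K)%VS]]|
    = #|[set L in B | (f @: T <= L)%VS]|.
Proof.
have injf : {in [set L in B | (f @: T <= L)%VS] &, injective (lfun_preim f)}.
  move=> L L' _ _ eqL.
  by rewrite -[L](@lpreimK _ _ _ f) ?eqL ?lpreimK // limg_f subvf.
rewrite -(card_in_imset injf); apply: eq_card => K; rewrite inE.
apply/and3P/imsetP => [[kK KB TK]|[L]].
  by exists (f @: K)%VS; rewrite ?limgK // inE KB limgS.
rewrite inE => /andP[LB TL] ->.
by rewrite lker_lpreim lpreimK ?limg_f ?subvf // subv_lpreim.
Qed.

(** The K lying over a fixed L are the k-spaces of its (k+1)-dimensional preimage that avoid the
    kernel. Those containing [T] are all k-spaces between [T] and the preimage, less those that also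
    contain the kernel; both numbers are the same for every L. *)
Lemma card_lift_nsub k t : exists c, forall B T,
  {in B, forall L, \dim L = k} -> \dim T = t -> ~~ (lker f <= T)%VS ->
  #|[set K | [&& ~~ (lker f <= K)%VS, (f @: K)%VS \in B & (T <= K)%VS]]|
    = #|[set L in B | (f @: T <= L)%VS]| * c.
Proof.
have [g hg] := card_between_uniform V k.+1 k t.
have [g' hg'] := card_between_uniform V k.+1 k t.+1.
exists (g - g') => B T dB dT kT.
rewrite -sum_nat_const -sum1_card (partition_big (fun K => f @: K)%VS
  [in [set L in B | (f @: T <= L)%VS]]) /=; last first.
  by move=> K; rewrite !inE => /and3P[_ -> /(limgS f)].
apply: eq_bigr => L; rewrite inE => /andP[LB TL].
have TM : (T <= f @^-1: L)%VS by rewrite subv_lpreim.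
have dM : \dim (f @^-1: L) = k.+1 by rewrite dim_lpreim dB.
have TkM : (T + lker f <= f @^-1: L)%VS by rewrite subv_add TM lker_lpreim.
have dTk : \dim (T + lker f) = t.+1.
  by rewrite dimv_disjoint_sum ?capv_lker0 // dT dim_ker addn1.
rewrite -(hg _ _ dM dT TM) -(hg' _ _ dM dTk TkM) sum1dep_card.
rewrite -(cardsID [set K | (lker f <= K)%VS] [set K | [&& \dim K == k, _ & _]]).
rewrite (_ : _ :&: _ =
  [set K | [&& \dim K == k, T + lker f <= K & K <= f @^-1: L]]%VS); last first.
  apply/setP => K; rewrite !inE subv_add -!andbA.
  by congr (_ && (_ && _)); rewrite andbC.
rewrite addKn; apply: eq_card => K; rewrite !inE subv_lpreim -!andbA.
apply/and4P/and4P => [[kK KB TK /eqP fK]|[kK /eqP dK TK fK]].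
  by rewrite -fK -(dim_limg_nsub kK) fK dB.
(* Avoiding the kernel, K keeps its dimension k under [f], so its image fills L. *)
have /eqP eqL : (f @: K)%VS == L by rewrite eqEdim fK dB // dim_limg_nsub // dK /=.
by rewrite eqL.
Qed.

End Quotient.

(** By [design_step] with M the whole space, lambda' depends on the parameters only. Chosen before
    [B], it serves all parts of a large set at once. *)
Lemma subspace_design_reduce (F : finFieldType) (V : vectType F)
    (t v k lambda : nat) :
  t < k -> exists lambda', forall B : {set {vspace V}},
    subspace_design t.+1 v k lambda B -> subspace_design t v k lambda' B.
Proof.
move=> lt_tk; pose c := #|F| ^ k - #|F| ^ t.
have c_gt0 : 0 < c by rewrite subn_gt0 ltn_exp2l ?finNzRing_gt1.
exists ((#|F| ^ v - #|F| ^ t) * lambda %/ c) => B [dV dB hB].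
split=> // S dS; rewrite -dV -(@design_step _ _ B fullv S k t) ?mulnK ?subvf //.
  by move=> K /dB; rewrite subvf.
by move=> T _; apply: hB.
Qed.

Lemma exists_inj_lfun (F : fieldType) (V W : vectType F) :
  \dim {:V} <= \dim {:W} -> exists h : 'Hom(V, W), lker h == 0%VS.
Proof.
rewrite !dimvf => leVW.
exists (Hom (pid_mx (dim V) : 'M_(dim V, dim W))).
apply/lker0P => x y; rewrite !unlock /=.
move/VectorInternalTheory.r2v_inj.
(* The transposed truncated identity is a right inverse. *)
move/(congr1 (mulmxr (pid_mx (dim V) : 'M_(dim W, dim V)))).
rewrite /= -!mulmxA mul_pid_mx minnn (minn_idPr leVW) pid_mx_1 !mulmx1.
exact: VectorInternalTheory.v2r_inj.
Qed.

(** The two given large sets may live on different spaces. Here V is W1 x F, [f1] is the first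
    projection, and [f2] is [f1] followed by an isomorphism from W1 to W2, so the kernels agree. *)
Lemma exists_common_quotient (F : fieldType) (W1 W2 : vectType F) :
  \dim {:W1} = \dim {:W2} ->
  exists (V : vectType F) (f1 : 'Hom(V, W1)) (f2 : 'Hom(V, W2)),
    [/\ \dim {:V} = (\dim {:W1}).+1, limg f1 = fullv, limg f2 = fullv,
        \dim (lker f1) = 1 & lker f2 = lker f1].
Proof.
move=> eqd; have [h h0] := exists_inj_lfun (eq_leq eqd).
pose f1 : 'Hom((W1 * F^o)%type, W1) := linfun fst.
have lim1 : limg f1 = fullv.
  apply/vspaceP => x; rewrite memvf; apply/memv_imgP.
  by exists (x, 0%R); rewrite ?memvf // lfunE.
have dV : \dim {:(W1 * F^o)%type} = (\dim {:W1}).+1 by rewrite !dimvf -[RHS]addn1.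
exists (W1 * F^o)%type, f1, (h \o f1)%VF; split=> //.
- rewrite limg_comp lim1; apply/eqP; rewrite eqEdim subvf /= -eqd.
  by rewrite limg_dim_eq // (eqP h0) capv0.
- have := limg_ker_dim f1 fullv; rewrite capfv lim1 dV -add1n; apply: addIn.
- apply/vspaceP => x; rewrite !memv_ker comp_lfunE.
  by rewrite -[LHS]memv_ker (eqP h0) memv0.
Qed.

Theorem corollary20 (F : finFieldType) (N t k v : nat)
    (hN : (1 <= N)%N) (htk : (t < k)%N) (htv : (t < v)%N) :
  large_set_exists F N t k.-1 v.-1 ->
  large_set_exists F N t k v.-1 ->
  large_set_exists F N t k v.
Proof.
(* From here on [k] and [v] stand for the k-1 and v-1 of the statement. *)
case: k htk => // k le_tk; case: v htv => // v le_tv /=.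
case=> W1 [B1 [dW1 [l1 des1] dis1 cov1]] [W2 [B2 [dW2 [l2 des2] dis2 cov2]]].
have [V [f1 [f2 [dV lim1 lim2 dk1 ker2]]]] :=
  exists_common_quotient (etrans dW1 (esym dW2)).
have dk2 : \dim (lker f2) = 1 by rewrite ker2.
set P := lker f1 in dk1 ker2.
have dB1 i K : K \in B1 i -> \dim K = k by case: (des1 i) => _ + _ => /[apply].
have dB2 i K : K \in B2 i -> \dim K = k.+1.
  by case: (des2 i) => _ + _ => /[apply].
pose B i := [set K : {vspace V} |
  if (P <= K)%VS then (f1 @: K)%VS \in B1 i else (f2 @: K)%VS \in B2 i].
have dB i K : K \in B i -> \dim K = k.+1.
  rewrite inE; case: ifP => PK.
    by move/dB1 => <-; rewrite (dim_limg_sub dk1).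
  by move/dB2 => <-; rewrite (dim_limg_nsub dk2) // ker2 PK.
have disB i j : i != j -> [disjoint B i & B j].
  move=> nij; rewrite -setI_eq0; apply/eqP/setP => K; rewrite !inE.
  case: ifP => _; apply/negP => /andP[Ki Kj].
    have /disjoint_setI0/setP/(_ (f1 @: K)%VS) := dis1 i j nij.
    by rewrite !inE Ki Kj.
  have /disjoint_setI0/setP/(_ (f2 @: K)%VS) := dis2 i j nij.
  by rewrite !inE Ki Kj.
have covB : \bigcup_(i < N) B i = [set K | \dim K == k.+1].
  apply/setP => K; rewrite inE; apply/bigcupP/eqP => [[i _ /dB]//|dK].
  have [PK|PK] := boolP (P <= K)%VS.
    have: (f1 @: K)%VS \in \bigcup_(i < N) B1 i.
      by rewrite cov1 inE -eqSS -(dim_limg_sub dk1) // dK.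
    by case/bigcupP => i _ Ki; exists i; rewrite // inE PK.
  have: (f2 @: K)%VS \in \bigcup_(i < N) B2 i.
    by rewrite cov2 inE (dim_limg_nsub dk2) ?ker2 // dK.
  by case/bigcupP => i _ Ki; exists i; rewrite // inE (negPf PK).
pose n i T := #|[set K in B i | (T <= K)%VS]|.
have equin T i j : \dim T = t -> n i T = n j T.
  have splitn i' : n i' T =
      #|[set K | [&& (P <= K)%VS, (f1 @: K)%VS \in B1 i' & (T <= K)%VS]]| +
      #|[set K | [&& ~~ (P <= K)%VS, (f2 @: K)%VS \in B2 i' & (T <= K)%VS]]|.
    rewrite /n -(cardsID [set K | (P <= K)%VS]).
    by congr (_ + _); apply: eq_card => K; rewrite !inE; case: (P <= K)%VS;
       rewrite ?andbT ?andbF.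
  move=> dT; rewrite !splitn !(card_lift_sub lim1 dk1).
  (* If P lies in T, only the K through P count, and the image of T has dimension t-1: the first
     large set is needed at strength t-1. Otherwise both images of T have dimension t, and the count
     is [l1 + l2 * c]. *)
  have [PT|PT] := boolP (P <= T)%VS.
    have dfT : t = (\dim (f1 @: T)).+1 by rewrite -(dim_limg_sub dk1) ?dT.
    have noC i' : #|[set K | [&& ~~ (P <= K)%VS, (f2 @: K)%VS \in B2 i'
        & (T <= K)%VS]]| = 0.
      apply/eqP; rewrite cards_eq0; apply/eqP/setP => K; rewrite !inE.
      by apply/and3P => -[/negP PK _ TK]; apply/PK/(subv_trans PT).
    rewrite !noC !addn0; rewrite dfT ?ltnS in le_tk des1.
    have [l' red] := subspace_design_reduce W1 v l1 le_tk.
    have [_ _ ->//] := red _ (des1 i).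
    by have [_ _ ->//] := red _ (des1 j).
  have [c hc] := card_lift_nsub lim2 dk2 k.+1 t.
  have ker2T : ~~ (lker f2 <= T)%VS by rewrite ker2.
  rewrite -ker2 !(hc _ _ _ dT ker2T); try exact: dB2.
  have [_ _ ->] := des1 i; last by rewrite (dim_limg_nsub dk1).
  have [_ _ ->] := des1 j; last by rewrite (dim_limg_nsub dk1).
  have [_ _ ->] := des2 i; last by rewrite (dim_limg_nsub dk2).
  by have [_ _ ->] := des2 j; last by rewrite (dim_limg_nsub dk2).
have [g hg] := card_between_uniform V v.+1 k.+1 t.
have dVv : \dim {:V} = v.+1 by rewrite dV dW1.
exists V, B; split=> //; exists (g %/ N) => i; split=> // [K|T dT]; first exact: dB.
(* The parts partition the blocks, so each block containing T is counted once; by [equin] the N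
   summands are equal, and [g %/ N] is exact. *)
have <- : \sum_(j < N) n j T = g.
  rewrite -(hg fullv T) ?subvf //.
  under eq_bigr => j _ do rewrite /n -sum1dep_card big_mkcondr.
  rewrite -(partition_disjoint_bigcup _ _ disB) covB -big_mkcondr sum1dep_card.
  by apply: eq_card => K; rewrite !inE subvf andbT.
rewrite (eq_bigr (fun=> n i T)) => [|j _]; last exact: equin.
by rewrite sum_nat_const card_ord mulKn.
Qed.
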